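(* Let $c>0$. Let $\omega_i^{(m)}=\mathbf{e}_i^T\mathbf{y}_m$ and $\omega_i^{(c,m)}=\mathbf{e}_i^T\mathbf{y}_m^{(c)}$, $1\le i\le m$, be the $i$-th coefficients, in the Lanczos basis $v_1,\dots,v_m$, of the $m$-th CGNE iterate $x_m=V_m\mathbf{y}_m$, where $\mathbf{T}_m\mathbf{y}_m=b_1\mathbf{e}_1$, and of the $m$-th CG-Tikhonov iterate $x_m^{(c)}=V_m\mathbf{y}_m^{(c)}$, where $(\mathbf{T}_m+c\mathbf{I})\mathbf{y}_m^{(c)}=b_1\mathbf{e}_1$. Then for each $1\le i\le m$, $$\omega_i^{(c,m)}=\left(1-\frac{g_m(c)\,\phi_{i+1}^{(m)}-h_{i+1}^{(m)}(c)\,\det\mathbf{T}_m}{\phi_{i+1}^{(m)}\left(\det\mathbf{T}_m+g_m(c)\right)}\right)\omega_i^{(m)} .$$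
   Context: $\mathcal{X},\mathcal{Y}$ are real separable Hilbert spaces, $A:\mathcal{X}\to\mathcal{Y}$ is a compact linear operator with adjoint $A^\ast$, and $y^\delta\in\mathcal{Y}$ with $A^\ast y^\delta\neq 0$. Lanczos process: $b_1=\|A^\ast y^\delta\|_{\mathcal{X}}$, $v_1=A^\ast y^\delta/b_1$, $v_0=0$, and for $i\ge 1$ $$A^\ast A v_i=b_{i+1}v_{i+1}+a_iv_i+b_iv_{i-1}\quad(\text{the last term absent for } i=1),$$ where $a_i=(A^\ast Av_i,v_i)_{\mathcal{X}}$ and $b_{i+1}=\|A^\ast Av_i-a_iv_i-b_iv_{i-1}\|_{\mathcal{X}}$. Fix $m\ge1$ such that the process does not break down before $v_1,\dots,v_m$ are produced (i.e. $b_2,\dots,b_m>0$). $V_m:\mathbb{R}^m\to\mathcal{X}$ is $V_m(\xi_i)_{i=1}^m=\sum_{i=1}^m\xi_iv_i$. $\mathbf{T}_m\in\mathbb{R}^{m\times m}$ is the symmetric tridiagonal matrix with diagonal entries $a_1,\dots,a_m$ and $(i-1,i)$ and $(i,i-1)$ entries $b_i$ for $2\le i\le m$. $\mathbf{e}_i$ is the $i$-th standard basis vector of $\mathbb{R}^m$. $\theta_0=1$, $\theta_1=a_1$, $\theta_\ell=a_\ell\theta_{\ell-1}-b_\ell^2\theta_{\ell-2}$ for $2\le\ell\le m$. $\phi_{m+1}^{(m)}=1$, $\phi_m^{(m)}=a_m$, $\phi_\ell^{(m)}=a_\ell\phi_{\ell+1}^{(m)}-b_{\ell+1}^2\phi_{\ell+2}^{(m)}$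 for $\ell=m-1,\dots,1$. $g_0(c)=0$, $g_1(c)=c$, $g_\ell(c)=(a_\ell+c)g_{\ell-1}(c)-b_\ell^2g_{\ell-2}(c)+c\,\theta_{\ell-1}$ for $2\le\ell\le m$. $h_{m+1}^{(m)}(c)=0$, $h_m^{(m)}(c)=c$, $h_\ell^{(m)}(c)=(a_\ell+c)h_{\ell+1}^{(m)}(c)-b_{\ell+1}^2h_{\ell+2}^{(m)}(c)+c\,\phi_{\ell+1}^{(m)}$ for $\ell=m-1,\dots,1$. *)

(* Defs.v *)
From HB Require Import structures.
From mathcomp Require Import all_boot all_order all_algebra.
From mathcomp Require Import all_classical all_reals all_analysis.

Set Implicit Arguments.
Unset Strict Implicit.
Unset Printing Implicit Defensive.

Import Order.TTheory GRing.Theory Num.Theory.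
Import numFieldNormedType.Exports.

Local Open Scope classical_set_scope.
Local Open Scope ring_scope.

(* A real Hilbert space is a complete normed module [X] over [R : realType]
   together with a positive definite symmetric bilinear form
   [ip : {dot X for idfun}] that induces the norm of [X]. *)
Definition induces_norm (R : realType) (X : normedModType R)
    (ip : {dot X for idfun}) :=
  forall x : X, `|x| = Num.sqrt (ip x x).

Definition separable (T : topologicalType) :=
  exists2 S : set T, countable S & dense S.

Definition compact_operator (R : realType) (X Y : normedModType R)
    (A : X -> Y) :=
  forall B : set X, bounded_set B -> precompact (A @` B).

Definition adjoint (R : realType) (X Y : normedModType R)
    (ipX : {dot X for idfun}) (ipY : {dot Y for idfun})
    (A : X -> Y) (Astar : Y -> X) :=
  forall x y, ipY (A x) y = ipX x (Astar y).

Section Lanczos.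
Variables (R : realType) (X Y : normedModType R) (ipX : {dot X for idfun}).
Variables (A : X -> Y) (Astar : Y -> X) (y : Y).

(* [lanczos i] is the triple (v_i, b_{i+1}, v_{i+1}).  Since v_0 = 0, the term
   b_1 v_0 contributes nothing to the first step.  After a breakdown
   (b_{i+1} = 0) the vector v_{i+1} is 0. *)
Fixpoint lanczos (i : nat) : X * R * X :=
  match i with
  | 0%N => let w := Astar y in (0, `|w|, `|w|^-1 *: w)
  | i'.+1 =>
      let: (u, b, v) := lanczos i' in
      let z := Astar (A v) in
      let w := z - ipX z v *: v - b *: u in
      (v, `|w|, `|w|^-1 *: w)
  end.

(* Indices are 1-based; [lanczos_b 0] is a junk value. *)
Definition lanczos_v (i : nat) : X := (lanczos i).1.1.
Definition lanczos_a (i : nat) : R :=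
  ipX (Astar (A (lanczos_v i))) (lanczos_v i).
Definition lanczos_b (i : nat) : R := (lanczos i.-1).1.2.

Lemma lanczos_v0 : lanczos_v 0 = 0. Proof. by []. Qed.

Lemma lanczos_b1 : lanczos_b 1 = `|Astar y|. Proof. by []. Qed.

Lemma lanczos_v1 : lanczos_v 1 = (lanczos_b 1)^-1 *: Astar y.
Proof. by []. Qed.

Lemma lanczos_bS (i : nat) : (0 < i)%N ->
  lanczos_b i.+1 = `|Astar (A (lanczos_v i)) - lanczos_a i *: lanczos_v i
                     - lanczos_b i *: lanczos_v i.-1|.
Proof.
case: i => // i _; rewrite /lanczos_b /lanczos_a /lanczos_v /=.
by case: (lanczos i) => -[u b] v.
Qed.

Lemma lanczos_three_term (i : nat) : (0 < i)%N ->
  Astar (A (lanczos_v i)) = lanczos_b i.+1 *: lanczos_v i.+1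
    + lanczos_a i *: lanczos_v i + lanczos_b i *: lanczos_v i.-1.
Proof.
case: i => // i _; rewrite /lanczos_b /lanczos_a /lanczos_v /=.
case: (lanczos i) => -[u b] v /=; set w := _ - _ - _.
have -> : `|w| *: (`|w|^-1 *: w) = w.
  have [->|w0] := eqVneq w 0; first by rewrite !scaler0.
  by rewrite scalerA divff ?scale1r // normr_eq0.
by rewrite /w addrAC !subrK.
Qed.

Definition lanczos_V (m : nat) (xi : 'cV[R]_m) : X :=
  \sum_(i < m) xi i 0 *: lanczos_v i.+1.

(* The matrix row and column i : 'I_m stand for the 1-based index i.+1. *)
Definition lanczos_T (m : nat) : 'M[R]_m :=
  \matrix_(i < m, j < m)
    if i == j :> nat then lanczos_a i.+1
    else if j == i.+1 :> nat then lanczos_b j.+1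
    else if i == j.+1 :> nat then lanczos_b i.+1
    else 0.

Definition e1 (m : nat) : 'cV[R]_m := \col_(i < m) (i == 0%N :> nat)%:R.

(* [x] is the m-th CGNE iterate and [w] its coefficient vector. *)
Definition cgne_iterate (m : nat) (x : X) (w : 'cV[R]_m) :=
  lanczos_T m *m w = lanczos_b 1 *: e1 m /\ x = lanczos_V w.

(* [x] is the m-th CG-Tikhonov iterate and [w] its coefficient vector. *)
Definition cg_tikhonov_iterate (c : R) (m : nat) (x : X) (w : 'cV[R]_m) :=
  (lanczos_T m + c%:M) *m w = lanczos_b 1 *: e1 m /\ x = lanczos_V w.

End Lanczos.

Section Recurrences.
Variables (R : realType) (a b : nat -> R).

Fixpoint theta (l : nat) : R :=
  match l with
  | 0%N => 1
  | 1%N => a 1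
  | (l''.+1 as l').+1 => a l * theta l' - b l ^+ 2 * theta l''
  end.

Fixpoint g (c : R) (l : nat) : R :=
  match l with
  | 0%N => 0
  | 1%N => c
  | (l''.+1 as l').+1 =>
      (a l + c) * g c l' - b l ^+ 2 * g c l'' + c * theta l'
  end.

(* [phi_rev m k] and [h_rev m c k] are the terms of index m + 1 - k of the
   descending recurrences; in the last branch this index is m - k''. *)
Fixpoint phi_rev (m k : nat) : R :=
  match k with
  | 0%N => 1
  | 1%N => a m
  | (k''.+1 as k').+1 =>
      let l := (m.+1 - k)%N in
      a l * phi_rev m k' - b l.+1 ^+ 2 * phi_rev m k''
  end.

Definition phi (m l : nat) : R := phi_rev m (m.+1 - l).

Fixpoint h_rev (m : nat) (c : R) (k : nat) : R :=
  match k with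
  | 0%N => 0
  | 1%N => c
  | (k''.+1 as k').+1 =>
      let l := (m.+1 - k)%N in
      (a l + c) * h_rev m c k' - b l.+1 ^+ 2 * h_rev m c k''
        + c * phi m l.+1
  end.

Definition h (m : nat) (c : R) (l : nat) : R := h_rev m c (m.+1 - l).

Lemma phi_last (m : nat) : phi m m.+1 = 1 /\ phi m m = a m.
Proof. by rewrite /phi subnn subSnn. Qed.

Lemma phi_step (m l : nat) : (0 < l < m)%N ->
  phi m l = a l * phi m l.+1 - b l.+1 ^+ 2 * phi m l.+2.
Proof.
case/andP=> _ lm; rewrite /phi !subSS; case: m lm => // m; rewrite ltnS => lm.
have -> : (m.+2 - l)%N = (m - l).+2 by rewrite !subSn // leqW.
rewrite (subSn lm) /= (_ : (m.+2 - (m - l).+2)%N = l) //.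
by rewrite !subSS subKn.
Qed.

Lemma h_last (m : nat) (c : R) : h m c m.+1 = 0 /\ h m c m = c.
Proof. by rewrite /h subnn subSnn. Qed.

Lemma h_step (m : nat) (c : R) (l : nat) : (0 < l < m)%N ->
  h m c l = (a l + c) * h m c l.+1 - b l.+1 ^+ 2 * h m c l.+2
            + c * phi m l.+1.
Proof.
case/andP=> _ lm; rewrite /h !subSS; case: m lm => // m; rewrite ltnS => lm.
have -> : (m.+2 - l)%N = (m - l).+2 by rewrite !subSn // leqW.
rewrite (subSn lm) /= (_ : (m.+2 - (m - l).+2)%N = l) //.
by rewrite !subSS subKn.
Qed.

End Recurrences.

(* Main.v *)
Require Import Defs.
From HB Require Import structures.
From mathcomp Require Import all_boot all_order all_algebra.
From mathcomp Require Import all_classical all_reals all_analysis.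
From mathcomp Require Import ring lra zify.

(* T_m is the matrix of A^*A in the orthonormal basis v_1, ..., v_m; as the v_i
   lie in the range of A^*, on which A is injective, T_m is positive definite.
   Multiplying T_m by the vector of entries
   (-1)^(j-1) b_2 ... b_j phi_{j+1}, truncated to j >= l, leaves only phi_l (up
   to sign) among the rows >= l.  The quadratic form at this vector thus gives
   phi_l phi_{l+1} > 0, and the case l = 1 solves T_m y = b_1 e_1 explicitly.
   The same holds for T_m + c I, whose leading and trailing minors are
   theta_l + g_l(c) and phi_l + h_l(c); the claim is the quotient of the two
   explicit solutions, with det T_m = theta_m = phi_1. *)

Set Implicit Arguments.
Unset Strict Implicit.
Unset Printing Implicit Defensive.

Import Order.TTheory GRing.Theory Num.Theory.
Import numFieldNormedType.Exports.

Local Open Scope classical_set_scope.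
Local Open Scope ring_scope.

(** * Positive definite matrices *)

Definition posdefmx (R : numDomainType) (n : nat) (M : 'M[R]_n) :=
  forall x : 'cV[R]_n, x != 0 -> 0 < \sum_i x i 0 * (M *m x) i 0.

Lemma posdefmx_inj (R : numDomainType) (n : nat) (M : 'M[R]_n) :
  posdefmx M -> injective (mulmx M : 'cV[R]_n -> _).
Proof.
move=> Mpos x y Mxy; apply/eqP; rewrite -subr_eq0; apply/negPn/negP => /Mpos.
rewrite mulmxBr Mxy subrr big1 ?ltxx // => i _.
by rewrite [X in _ * X]mxE mulr0.
Qed.

Lemma posdefmxD_scalar (R : realDomainType) (n : nat) (M : 'M[R]_n) (c : R) :
  posdefmx M -> 0 <= c -> posdefmx (M + c%:M).
Proof.
move=> Mpos c0 x x0; rewrite mulmxDl mul_scalar_mx.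
rewrite (eq_bigr (fun i => x i 0 * (M *m x) i 0 + c * x i 0 ^+ 2)).
  rewrite big_split /= ltr_pwDl ?Mpos // sumr_ge0 // => i _.
  by rewrite mulr_ge0 ?sqr_ge0.
by move=> i _; rewrite !mxE; ring.
Qed.

(** * Symmetric tridiagonal matrices: minors, and the explicit solution of T x = r e_1 *)

Section Tridiagonal.
Variables (R : realType) (b : nat -> R).
Implicit Types (a : nat -> R) (c : R) (m : nat).

(* Row and column i : 'I_m carry the 1-based index i.+1. *)
Definition tridiag a m : 'M[R]_m :=
  \matrix_(i < m, j < m)
    if i == j :> nat then a i.+1
    else if j == i.+1 :> nat then b j.+1
    else if i == j.+1 :> nat then b i.+1
    else 0.

Lemma tridiagD_scalar a m c :
  tridiag a m + c%:M = tridiag (fun l => a l + c) m.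
Proof.
by apply/matrixP => i j; rewrite !mxE -val_eqE /=; case: eqP => _;
  rewrite ?mulr1n ?mulr0n ?addr0.
Qed.

(** Taking [f] on all of [nat] lets the neighbours be written [f i.-1] and [f i.+1]; the guards
    discard those outside the matrix. *)
Lemma tridiag_mulmx a m (f : nat -> R) (i : 'I_m) :
  (tridiag a m *m \col_j f j) i 0 =
    (if (0 < i)%N then b i.+1 * f i.-1 else 0) + a i.+1 * f i
    + (if (i.+1 < m)%N then b i.+2 * f i.+1 else 0).
Proof.
rewrite mxE (eq_bigr (fun j : 'I_m =>
  (if (0 < i)%N then if j == i.-1 :> nat then b i.+1 * f j else 0 else 0)
  + (if j == i :> nat then a i.+1 * f j else 0)
  + (if j == i.+1 :> nat then b j.+1 * f j else 0))); last first.
  move=> j _; rewrite !mxE; case: i => -[|i] ilt /=.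
    by case: j => -[|[|j]] jlt /=; rewrite ?mul0r ?addr0 ?add0r.
  rewrite eqSS ![_ == val j]eq_sym /=.
  have [->|ji] := eqVneq (val j) i.
    by rewrite !ltn_eqF // !addr0.
  have [->|ji1] := eqVneq (val j) i.+1; first by rewrite ltn_eqF // addr0 add0r.
  by case: eqP => _; rewrite ?mul0r !add0r.
rewrite !big_split /=; congr (_ + _ + _).
- case: ifP => i0; last by rewrite big1.
  rewrite -big_mkcond (big_ord1_eq _ (fun j => b i.+1 * f j)) ifT //.
  exact: leq_ltn_trans (leq_pred _) _.
- by rewrite -big_mkcond (big_ord1_eq _ (fun j => a i.+1 * f j)) ltn_ord.
- by rewrite -big_mkcond (big_ord1_eq _ (fun j => b j.+1 * f j)).
Qed.

Lemma thetaSS a l :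
  theta a b l.+2 = a l.+2 * theta a b l.+1 - b l.+2 ^+ 2 * theta a b l.
Proof. by []. Qed.

Lemma gSS a c l :
  g a b c l.+2 = (a l.+2 + c) * g a b c l.+1 - b l.+2 ^+ 2 * g a b c l
                 + c * theta a b l.+1.
Proof. by []. Qed.

(** Expansion along the last row leaves two cofactors; that of the off-diagonal entry, expanded
    along its last column, gives the second factor [b m] and the minor two sizes smaller. *)
Lemma det_tridiag a m : \det (tridiag a m) = theta a b m.
Proof.
elim/ltn_ind: m => -[_|[_|m IH]]; first by rewrite det_mx00.
  by rewrite det_mx11 mxE.
rewrite (expand_det_row _ ord_max) !big_ord_recr /= big1 ?add0r; last first.
  move=> i _; rewrite mxE /=.
  have iltm := ltn_ord i.
  by rewrite !ifN ?mul0r //; apply/eqP => /=; lia.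
rewrite addrC /cofactor /= addnn -mul2n exprM sqrrN !expr1n mul1r.
rewrite addSn addnn -mul2n exprS exprM sqrrN !expr1n mulr1.
rewrite !mxE /= eqxx gtn_eqF // ltn_eqF //.
have -> : row' ord_max (col' ord_max (tridiag a m.+2)) = tridiag a m.+1.
  by apply/matrixP => i j; rewrite !mxE !lift_max.
rewrite IH //; set N := row' _ _.
rewrite (expand_det_col _ ord_max) big_ord_recr /=.
have Nlast (i : 'I_m.+1) : N i ord_max = if i == m :> nat then b m.+2 else 0.
  rewrite !mxE lift_max /= /bump leqnn add1n.
  have iltm := ltn_ord i.
  by rewrite ltn_eqF // eqSS eq_sym; case: eqP => // _; rewrite ltn_eqF // ltnW.
rewrite big1 ?add0r; last first.
  by move=> i _; rewrite Nlast ltn_eqF ?mul0r //= ltn_ord.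
rewrite Nlast eqxx /cofactor /= addnn -mul2n exprM sqrrN !expr1n mul1r.
have -> : row' ord_max (col' ord_max N) = tridiag a m.
  apply/matrixP => i j; rewrite !mxE !lift_max /= /bump.
  have jm : (m <= j)%N = false by rewrite leqNgt (ltn_ord j).
  by rewrite !(jm, add0n).
by rewrite IH //=; ring.
Qed.

(** The recurrences of [theta] and [g] add up to that of [theta] for the shifted diagonal, so [g] is
    the increment of the leading minor. *)
Lemma thetaD_scalar a c l :
  theta (fun k => a k + c) b l = theta a b l + g a b c l.
Proof.
elim/ltn_ind: l => -[_|[_|l IH]] //; first by rewrite addr0.
by rewrite thetaSS gSS !IH // thetaSS; ring.
Qed.

Lemma phiD_scalar a c m l : (0 < l <= m.+1)%N ->
  phi (fun k => a k + c) b m l = phi a b m l + h a b m c l.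
Proof.
(* The recurrences descend in [l], hence induction on the distance to [m.+1]. *)
move=> /andP[l0 lm]; move: {2}(m.+1 - l)%N (erefl (m.+1 - l)%N) => k.
elim/ltn_ind: k l l0 lm => k IH l l0 lm mlk.
have [->|l1] := eqVneq l m.+1.
  by rewrite !(phi_last _ _ _).1 (h_last _ _ _ _).1 addr0.
have [->|l2] := eqVneq l m; first by
  rewrite !(phi_last _ _ _).2 (h_last _ _ _ _).2.
have ltlm : (0 < l < m)%N by lia.
rewrite !(phi_step _ _ ltlm) (h_step _ _ _ ltlm) (IH k.-1) ?(IH k.-2); try lia.
by ring.
Qed.

Lemma theta_phi a m : (0 < m)%N -> theta a b m = phi a b m 1.
Proof.
case: m => // m _; have [phi_last1 phi_last0] := phi_last a b m.+1.
case: m => [|m] in phi_last1 phi_last0 *; first by rewrite phi_last0.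
(* This combination of leading and trailing minors does not depend on [l]; its value at [l = m] is
   [theta] at [m.+2]. *)
suff inv l : (l <= m)%N -> theta a b l.+1 * phi a b m.+2 l.+2
    - b l.+2 ^+ 2 * theta a b l * phi a b m.+2 l.+3 = phi a b m.+2 1.
  by rewrite -(inv m) // phi_last0 phi_last1 thetaSS; ring.
elim: l => [_|l IH lm]; first by rewrite [RHS]phi_step //= mulr1.
by rewrite -IH ?(ltnW lm) // (@phi_step _ a b _ l.+2) // thetaSS; ring.
Qed.

(* [offdiag j * phi m j.+1] is, up to scaling, the j-th coefficient of the
   solution of T x = e_1. *)
Definition offdiag (j : nat) : R := \prod_(2 <= k < j.+1) - b k.

Lemma offdiagS j : (0 < j)%N -> offdiag j.+1 = - b j.+1 * offdiag j.
Proof. by move=> j0; rewrite /offdiag big_nat_recr //= mulrC. Qed.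

Lemma offdiag_neq0 m j : (forall i, (2 <= i <= m)%N -> b i != 0) ->
  (j <= m)%N -> offdiag j != 0.
Proof.
move=> b0 jm; rewrite /offdiag prodf_seq_neq0; apply/allP => k.
rewrite mem_index_iota => /andP[k2 kj] /=; rewrite oppr_eq0 b0 // k2 /=.
by rewrite (leq_trans _ jm) // -ltnS.
Qed.

(** Both [l] and [j] count from 0 while [phi] and [offdiag] count from 1; [l = 0] gives the
    untruncated vector. *)
Definition phi_vec a m (l : nat) : 'cV[R]_m :=
  \col_j if (l <= j)%N then offdiag j.+1 * phi a b m j.+2 else 0.

(** Below row [l] the three terms cancel by the recurrence of [phi]; in row [l] the left neighbour
    is cut off, and its absence leaves the [phi] term. *)
Lemma tridiag_phi_vec a m l (i : 'I_m) : (l <= i)%N ->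
  (tridiag a m *m phi_vec a m l) i 0 =
    if i == l :> nat then offdiag l.+1 * phi a b m l.+1 else 0.
Proof.
move=> li.
rewrite (tridiag_mulmx a
  (fun j => if (l <= j)%N then offdiag j.+1 * phi a b m j.+2 else 0)).
have ilt := ltn_ord i; have [phi1 phi0] := phi_last a b m.
rewrite li leqW //.
(* In the last row both sides are 0, because [phi m m = a m] and [phi m m.+1 = 1]. *)
have -> : (if (i.+1 < m)%N then b i.+2 * (offdiag i.+2 * phi a b m i.+3) else 0)
    = offdiag i.+1 * (phi a b m i.+1 - a i.+1 * phi a b m i.+2).
  case: ltnP => im; first by
    rewrite (@phi_step _ a b _ i.+1) // offdiagS //; ring.
  have <- : m = i.+1 by lia.
  by rewrite phi1 phi0; ring.
have [->|il] := eqVneq (i : nat) l.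
  case: l li => [_|l li] /=; first by ring.
  by rewrite ltnn; ring.
have lti : (l < i)%N by lia.
rewrite ifT; last by lia.
case: (nat_of_ord i) lti => // j lj /=.
rewrite -ltnS lj (offdiagS (j := j.+1)) //; ring.
Qed.

Lemma phi_gt0 a m l : (forall i, (2 <= i <= m)%N -> b i != 0) ->
  posdefmx (tridiag a m) -> (0 < l <= m.+1)%N -> 0 < phi a b m l.
Proof.
move=> b0 Tpos; move: {2}(m.+1 - l)%N (leqnn (m.+1 - l)) => k.
elim: k l => [|k IH] l mlk /andP[l0 lm].
  have -> : l = m.+1 by lia.
  by rewrite (phi_last a b m).1.
have [->|lneq] := eqVneq l m.+1; first by rewrite (phi_last a b m).1.
case: l l0 mlk lm lneq => // l _ mlk lm lneq.
have {lm lneq} lm : (l < m)%N by lia.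
have phiS : 0 < phi a b m l.+2 by apply: IH; lia.
have s0 := offdiag_neq0 b0 lm.
have /Tpos : phi_vec a m l != 0.
  apply/eqP => /matrixP/(_ (Ordinal lm) 0); rewrite !mxE /= leqnn.
  by move/eqP; rewrite mulf_eq0 (negPf s0) gt_eqF.
(* Before [l] the vector vanishes, after [l] its image does: only the product at [l] survives in the
   quadratic form. *)
rewrite (bigD1 (Ordinal lm)) //= big1 ?addr0; last first.
  move=> i; rewrite -val_eqE /= => il; have [li|il'] := leqP l i.
    by rewrite tridiag_phi_vec // (negPf il) mulr0.
  by rewrite mxE leqNgt il' mul0r.
rewrite tridiag_phi_vec //= eqxx mxE /= leqnn mulrACA -expr2.
have s2 : 0 < offdiag l.+1 ^+ 2 by rewrite exprn_even_gt0.
by rewrite (pmulr_rgt0 _ s2) (pmulr_rgt0 _ phiS).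
Qed.

(** The full [phi_vec] is mapped to [phi a b m 1] times e_1, and T is injective; scaling by that
    minor avoids a division. *)
Lemma tridiag_solution a m (w : 'cV[R]_m) (r : R) :
  posdefmx (tridiag a m) -> tridiag a m *m w = r *: e1 R m ->
  forall i, phi a b m 1 * w i 0 = r * (offdiag i.+1 * phi a b m i.+2).
Proof.
move=> Tpos Tw i.
have /(posdefmx_inj Tpos)/matrixP/(_ i 0) :
    tridiag a m *m (phi a b m 1 *: w) = tridiag a m *m (r *: phi_vec a m 0).
  rewrite -!scalemxAr Tw; apply/matrixP => k j; rewrite ord1 {j}.
  rewrite mxE [RHS]mxE tridiag_phi_vec // !mxE /offdiag big_geq // mul1r.
  by case: eqP => _; rewrite ?mulr1 ?mulr0 // mulrC.
by rewrite !mxE.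
Qed.

Lemma tridiag_solutionD_scalar a m c (w wc : 'cV[R]_m) (r : R) :
  (forall i, (2 <= i <= m)%N -> b i != 0) -> posdefmx (tridiag a m) -> 0 <= c ->
  tridiag a m *m w = r *: e1 R m ->
  (tridiag a m + c%:M) *m wc = r *: e1 R m ->
  forall i, wc i 0 =
    (1 - (g a b c m * phi a b m i.+2 - h a b m c i.+2 * \det (tridiag a m))
         / (phi a b m i.+2 * (\det (tridiag a m) + g a b c m))) * w i 0.
Proof.
move=> b0 Tpos c0 Tw; have Tcpos := posdefmxD_scalar Tpos c0.
rewrite tridiagD_scalar in Tcpos * => Twc i.
have ilt := ltn_ord i; have m0 : (0 < m)%N by lia.
have wE := tridiag_solution Tpos Tw i.
have wcE := tridiag_solution Tcpos Twc i.
have := phi_gt0 (l := 1) b0 Tcpos isT.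
have := phi_gt0 (l := 1) b0 Tpos isT.
have := phi_gt0 (l := i.+2) b0 Tpos ilt.
rewrite -theta_phi // thetaD_scalar phiD_scalar // -theta_phi // in wcE *.
rewrite -theta_phi // in wE; rewrite det_tridiag.
move: (theta a b m) (g a b c m) (phi a b m i.+2) (h a b m c i.+2) wE wcE.
(* D and D + G are the determinants of T and T + cI; the bracket in the claim equals D (P + H) / (P
   (D + G)). *)
move=> D G P H wE wcE P0 D0 DG0.
have -> : w i 0 = r * (offdiag i.+1 * P) / D.
  by rewrite -wE mulrAC divff ?mul1r // gt_eqF.
have -> : wc i 0 = r * (offdiag i.+1 * (P + H)) / (D + G).
  by rewrite -wcE mulrAC divff ?mul1r // gt_eqF.
by field; rewrite !gt_eqF.
Qed.

End Tridiagonal.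

(** * Orthonormality of the Lanczos vectors and positive definiteness of T_m *)

Section LanczosMatrix.
Variables (R : realType) (X Y : normedModType R).
Variables (ipX : {dot X for idfun}) (ipY : {dot Y for idfun}).
Hypotheses (ipX_norm : induces_norm ipX).
Variables (A : {linear X -> Y}) (Astar : {linear Y -> X}) (y : Y).
Hypothesis A_adj : adjoint ipX ipY A Astar.
Variable m : nat.
Hypothesis b_gt0 : forall i, (1 <= i <= m)%N -> 0 < lanczos_b ipX A Astar y i.

Local Notation v := (lanczos_v ipX A Astar y).
Local Notation a := (lanczos_a ipX A Astar y).
Local Notation b := (lanczos_b ipX A Astar y).
Local Notation T := (lanczos_T ipX A Astar y m).
Local Notation V := (@lanczos_V R X Y ipX A Astar y m).

Lemma dot_sym (Z : lmodType R) (ip : {dot Z for idfun}) (u w : Z) :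
  ip u w = ip w u.
Proof. by rewrite hermC expr0 mul1r. Qed.

Lemma dot_norm (u : X) : ipX u u = `|u| ^+ 2.
Proof.
rewrite ipX_norm sqr_sqrtr //; have [->|/(neq0_dnorm_gt0 (s := ipX))/ltW//] :=
  eqVneq u 0; by rewrite linear0l.
Qed.

Lemma dot_normal_sym (u w : X) : ipX (Astar (A u)) w = ipX u (Astar (A w)).
Proof. by rewrite dot_sym -!A_adj dot_sym. Qed.

Lemma lanczos_vS i : (i < m)%N -> v i.+1 = (b i.+1)^-1 *:
  (if i is 0 then Astar y else Astar (A (v i)) - a i *: v i - b i *: v i.-1).
Proof.
case: i => // i im.
have bn0 : b i.+2 != 0 by rewrite lt0r_neq0 ?b_gt0.
rewrite -[LHS]scale1r -(mulVf bn0) -scalerA; congr (_ *: _).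
by rewrite lanczos_three_term // addrAC addrK addrK.
Qed.

(** Strong induction on the larger index, using that A^*A is self-adjoint. The factor [0 < i]
    accounts for v_0 = 0. *)
Lemma lanczos_orthonormal i j : (i <= m)%N -> (j <= m)%N ->
  ipX (v i) (v j) = ((0 < i)%N && (i == j))%:R.
Proof.
have v0l u : ipX (v 0) u = 0 by rewrite lanczos_v0 linear0l.
have v0r u : ipX u (v 0) = 0 by rewrite dot_sym v0l.
suff main n : (n <= m)%N -> forall j, (j <= n)%N ->
    ipX (v n) (v j) = ((0 < n)%N && (n == j))%:R.
  case: (leqP j i) => [ji im _|/ltnW ij _ jm]; first exact: main.
  by rewrite dot_sym main // eq_sym; case: eqP => [->|]; rewrite ?andbF.
elim/ltn_ind: n {i j} => -[|n] IH nm j jn; first by rewrite v0l.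
have {}IH i k : (i <= n)%N -> (k <= n)%N ->
    ipX (v i) (v k) = ((0 < i)%N && (i == k))%:R.
  move=> iln kln; case: (leqP k i) => [ki|/ltnW ik].
    by apply: IH => //; lia.
  rewrite dot_sym IH; try lia.
  by rewrite eq_sym; case: eqP => [->|]; rewrite ?andbF.
have bn := b_gt0 (i := n.+1) nm.
have [->|jn1] := eqVneq j n.+1.
  have vn : `|v n.+1| = 1.
    rewrite lanczos_vS // normrZ gtr0_norm ?invr_gt0 //.
    case: (n) bn => [|k] bn; first by rewrite lanczos_b1 mulVf // gt_eqF.
    by rewrite lanczos_bS // mulVf // -lanczos_bS // gt_eqF.
  by rewrite dot_norm vn expr1n.
have {jn jn1} jn : (j <= n)%N by lia.
rewrite andbF lanczos_vS // linearZl_LR /=.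
case: n j jn IH nm {bn} => [|n] [|j] jn IH nm; rewrite ?v0r ?mulr0 //.
apply/eqP; rewrite mulf_eq0; apply/orP; right; apply/eqP.
rewrite !linearBl !linearZl_LR /= !IH; try lia.
have [<-|jneqn] := eqVneq j n.
  by rewrite -/(a j.+1) eqxx ltn_eqF // andbF mulr0 mulr1 subrr subr0.
(* With A^*A moved to the earlier vector, only its successor can meet v_(n+1); that contribution
   cancels the [b] term. *)
rewrite dot_normal_sym lanczos_three_term //.
rewrite !linearDr !linearZr_LR /= !IH; try lia.
rewrite !eqSS [n == j]eq_sym (negPf jneqn) /= [n.+1 == j]gtn_eqF; last by lia.
by case: eqP => [->|_]; rewrite ?andbF ?ltn0Sn ?andbT /=; ring.
Qed.

Lemma lanczos_range i : (i <= m)%N -> exists z, v i = Astar z.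
Proof.
elim/ltn_ind: i => -[_ _|i IH im]; first by exists 0; rewrite linear0.
rewrite lanczos_vS //; case: i im IH => [|i] im IH /=.
  by exists ((b 1)^-1 *: y); rewrite linearZ.
have [z ->] := IH i.+1 (leqnn _) (ltnW im).
have [z' ->] := IH i (leqnSn _) (ltnW (ltnW im)).
exists ((b i.+2)^-1 *: (A (Astar z) - a i.+1 *: z - b i.+1 *: z')).
by rewrite (linearZ_LR Astar) !(linearB Astar) !(linearZ_LR Astar).
Qed.

Lemma lanczos_T_dot (i j : 'I_m) : T i j = ipX (Astar (A (v j.+1))) (v i.+1).
Proof.
wlog ij : i j / (i <= j)%N.
  move=> main; have [|/ltnW ji] := leqP i j; first exact: main.
  rewrite dot_normal_sym dot_sym -(main _ _ ji) !mxE [j == i :> nat]eq_sym.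
  by case: eqP => [->//|_]; case: eqP => ji1; case: eqP => // ij1; lia.
have jm := ltn_ord j.
rewrite mxE; have [-> //|neqij] := eqVneq (i : nat) j.
(* The recurrence is expanded at the smaller index, so no vector beyond v_m appears. *)
rewrite [i == j.+1 :> nat]ltn_eqF // dot_normal_sym lanczos_three_term //=.
rewrite !linearDr !linearZr_LR /= !lanczos_orthonormal /=; try lia.
rewrite !eqSS [j == i :> nat]eq_sym (negPf neqij).
rewrite [j.+1 == i]gtn_eqF ?ltnS //= !mulr0 !addr0.
by case: eqP => [->|_]; rewrite ?mulr1 ?mulr0.
Qed.

Lemma lanczos_T_posdef : posdefmx T.
Proof.
move=> xi xi0; set u := V xi.
have TE i : (T *m xi) i 0 = ipX (Astar (A u)) (v i.+1).
  rewrite mxE !linear_sum linear_sumlz /=; apply: eq_bigr => j _.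
  by rewrite lanczos_T_dot !linearZ linearZl_LR /= mulrC.
have -> : \sum_i xi i 0 * (T *m xi) i 0 = ipY (A u) (A u).
  rewrite A_adj dot_sym {2}/u /lanczos_V linear_sumr; apply: eq_bigr => i _.
  by rewrite TE linearZr_LR.
apply: neq0_dnorm_gt0; apply: contra_neq xi0 => Au0.
have [z uE] : exists z, u = Astar z.
  have /choice[z zE] (i : 'I_m) := lanczos_range (ltn_ord i).
  exists (\sum_i xi i 0 *: z i); rewrite linear_sum; apply: eq_bigr => i _.
  by rewrite linearZ zE.
have u0 : u = 0.
  (* Since u = A^* z, (u, u) = (A u, z) = 0. *)
  apply/eqP/negPn/negP => /(neq0_dnorm_gt0 (s := ipX)).
  by rewrite {2}uE -A_adj Au0 linear0l ltxx.
(* By orthonormality, pairing u with a Lanczos vector recovers the coefficient. *)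
apply/matrixP => i j; rewrite ord1 mxE; transitivity (ipX u (v i.+1)).
  rewrite linear_sumlz (bigD1 i) //= big1 ?addr0 => [|k ki].
    by rewrite linearZl_LR /= lanczos_orthonormal //= eqxx mulr1.
  rewrite linearZl_LR /= lanczos_orthonormal //= eqSS.
  by rewrite (negPf ki : (k == i :> nat) = false) mulr0.
by rewrite u0 linear0l.
Qed.

End LanczosMatrix.

(** * Application to the CGNE and CG-Tikhonov coefficients *)

Theorem lemma6p1 (R : realType) (X Y : completeNormedModType R)
  (ipX : {dot X for idfun}) (ipY : {dot Y for idfun})
  (ipX_norm : induces_norm ipX) (ipY_norm : induces_norm ipY)
  (X_sep : separable X) (Y_sep : separable Y)
  (A : {linear X -> Y}) (Astar : {linear Y -> X})
  (A_compact : compact_operator A) (A_adj : adjoint ipX ipY A Astar)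
  (ydelta : Y) (ydelta_neq0 : Astar ydelta != 0)
  (m : nat) (m_ge1 : (1 <= m)%N)
  (no_breakdown : forall i : nat, (2 <= i <= m)%N ->
     0 < lanczos_b ipX A Astar ydelta i)
  (c : R) (c_gt0 : 0 < c)
  (x xc : X) (omega omegac : 'cV[R]_m)
  (x_cgne : cgne_iterate ipX A Astar ydelta x omega)
  (xc_tikhonov : cg_tikhonov_iterate ipX A Astar ydelta c xc omegac) :
  let a := lanczos_a ipX A Astar ydelta in
  let b := lanczos_b ipX A Astar ydelta in
  let T := lanczos_T ipX A Astar ydelta m in
  (* the 1-based index i of the coefficients is i.+1 for i : 'I_m *)
  forall i : 'I_m,
    omegac i 0 =
      (1 - (g a b c m * phi a b m i.+2 - h a b m c i.+2 * \det T)
           / (phi a b m i.+2 * (\det T + g a b c m))) * omega i 0.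
Proof.
move=> a b T i; case: x_cgne xc_tikhonov => [Tw _] [Twc _].
have b_gt0 k : (1 <= k <= m)%N -> 0 < b k.
  case: k => [//|[_|k km]]; last exact: no_breakdown.
  by rewrite /b lanczos_b1 normr_gt0.
apply: tridiag_solutionD_scalar Tw Twc i; last exact: ltW.
  by move=> k /andP[k2 km]; rewrite gt_eqF // b_gt0 // km ltnW.
exact: (lanczos_T_posdef ipX_norm A_adj b_gt0).
Qed.
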